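(* Fix integers $N,n\ge 1$ and a function $\phi:\mathbb{R}^N\to\mathbb{R}^n$, defining the model $f(x,a)=\phi(x)\cdot a$. The assignment to each weighted finite data set $\omega\mathscr{D}$ of its LS Koszul complex $K_\bullet(\mathcal{R}^{\omega\mathscr{D}})$, and to each morphism $\rho:\omega\mathscr{D}\to\omega\mathscr{D}'$ of weighted finite data sets of the map $\mathcal{K}(\rho):K_\bullet(\mathcal{R}^{\omega\mathscr{D}'})\to K_\bullet(\mathcal{R}^{\omega\mathscr{D}})$ induced by the ring morphism $\rho^*:\mathcal{R}^{\omega\mathscr{D}'}\to\mathcal{R}^{\omega\mathscr{D}}$, is a presheaf of chain complexes $\mathcal{K}:\mathbf{\Omega Fin}^{op}\to\mathbf{Ch}_\bullet$.
   Context: Ambient space: $X\times Y=\mathbb{R}^N\times\mathbb{R}$. Parameter space: $\Lambda=\mathbb{R}^n$, with coordinates $a=(a^1,\dots,a^n)$. Model: $f:X\times\Lambda\to\mathbb{R}$, $f(x,a)=\phi(x)\cdot a=\sum_{\ell=1}^n\phi(x)^\ell a^\ell$, linear in $a$. Weighted finite data sets: a weighted finite data set (weighted finite subset) $\omega\mathscr{D}$ is a function $[m]=\{1,\dots,m\}\to X\times Y\times\mathbb{R}$, $j\mapsto(x^j,y^j,\omega^j)$, for some $m$; $\mathscr{D}$ is the underlying data set of points $(x^j,y^j)$. The category $\mathbf{\Omega Fin}$ has these as objects; a morphism $\rho:\omega\mathscr{D}\to\omega\mathscr{D}'$, with index sets $[m]$ and $[m']$, is an injection $\rho:[m]\hookrightarrow[m']$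 such that the function defining $\omega\mathscr{D}'$ composed with $\rho$ equals the function defining $\omega\mathscr{D}$. Rings: $\mathcal{R}^{\omega\mathscr{D}}=\mathbb{R}[a^1,\dots,a^n,\omega^1,\dots,\omega^m]$ is the polynomial ring in which $a^i$ are parameter variables and $\omega^j$ are formal weight variables, one for each data point. For a morphism $\rho:\omega\mathscr{D}\to\omega\mathscr{D}'$, the $\mathbb{R}$-algebra morphism $\rho^*:\mathcal{R}^{\omega\mathscr{D}'}\to\mathcal{R}^{\omega\mathscr{D}}$ is given by $a^i\mapsto a^i$, and $\omega^{j'}\mapsto\omega^j$ if $j'=\rho(j)$, $\omega^{j'}\mapsto 0$ if $j'\notin\rho([m])$. Koszul complex: given a commutative ring $\mathcal{R}$ and $\eta^1,\dots,\eta^n\in\mathcal{R}$, $K_p(\mathcal{R})$ is the $p$-th exterior power of the free $\mathcal{R}$-module with basis $e^1,\dots,e^n$, with differential $\iota:K_{p+1}\to K_p$, $\iota(e^{i_0}\wedge\cdots\wedge e^{i_p})=\sum_{j=0}^p(-1)^j\eta^{i_j}\,e^{i_0}\wedge\cdots\widehat{e^{i_j}}\cdots\wedge e^{i_p}$. The LS Koszul complex $K_\bullet(\mathcal{R}^{\omega\mathscr{D}})$ is the Koszul complex over $\mathcal{R}=\mathcal{R}^{\omega\mathscr{D}}$ with $$\eta^i=\frac{\partial}{\partial a^i}\sum_{j=1}^m\bigl(y^j-\phi(x^j)\cdot a\bigr)^2\,\omega^j\in\mathcal{R}^{\omega\mathscr{D}},\qquad i=1,\dots,n.$$ The map induced by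 $\rho^*$ applies $\rho^*$ to the coefficients with respect to the basis elements $e^{i_1}\wedge\cdots\wedge e^{i_p}$. $\mathbf{Ch}_\bullet$ is the category of chain complexes (of real vector spaces; each map $\mathcal{K}(\rho)$ is moreover semilinear over $\rho^*$). *)

(* Defs.v *)
From HB Require Import structures.
From mathcomp Require Import all_boot all_order all_algebra.
From mathcomp Require Import perm.
From mathcomp Require Import boolp reals.
From mathcomp Require Import mpoly.

Set Implicit Arguments.
Unset Strict Implicit.
Unset Printing Implicit Defensive.

Import GRing.Theory.
Local Open Scope ring_scope.

Record category := Category {
  ob :> Type;
  hom : ob -> ob -> Type;
  idm : forall a, hom a a;
  comp : forall a b c, hom b c -> hom a b -> hom a c;
  comp1m : forall a b (f : hom a b), comp (idm b) f = f;
  compm1 : forall a b (f : hom a b), comp f (idm a) = f;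
  compA : forall a b c d (h : hom c d) (g : hom b c) (f : hom a b),
    comp h (comp g f) = comp (comp h g) f }.

Definition opposite (C : category) : category :=
  @Category C (fun a b => hom b a) (@idm C)
    (fun a b c g f => comp f g)
    (fun a b f => compm1 f) (fun a b f => comp1m f)
    (fun a b c d h g f => esym (compA f g h)).

Definition is_functor (C D : category) (F0 : C -> D)
    (F1 : forall a b : C, hom a b -> hom (F0 a) (F0 b)) : Prop :=
  (forall a, F1 a a (idm a) = idm (F0 a)) /\
  (forall a b c (g : hom b c) (f : hom a b),
     F1 a c (comp g f) = comp (F1 b c g) (F1 a b f)).

Section ChainComplexes.
Variable R : nzRingType.

(* Candidate data of an N-graded chain complex, before the axioms are known. *)
Record graded := Graded {
  gmod :> nat -> lmodType R;
  gdiff : forall p, gmod p.+1 -> gmod p }.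

Definition is_complex (C : graded) : Prop :=
  (forall p, linear (@gdiff C p)) /\
  (forall p (x : C p.+2), gdiff (gdiff x) = 0).

Definition is_chain_map (C D : graded) (f : forall p, C p -> D p) : Prop :=
  (forall p, linear (f p)) /\
  (forall p (x : C p.+1), f p (gdiff x) = gdiff (f p.+1 x)).

Record complex := Complex { cgraded :> graded; complexP : is_complex cgraded }.

Record chain_map (C D : complex) := ChainMap {
  cmfun :> forall p, C p -> D p;
  chain_mapP : is_chain_map cmfun }.

Lemma chain_map_inj (C D : complex) (f g : chain_map C D) :
  (forall p x, f p x = g p x) -> f = g.
Proof.
case: f g => [f Hf] [g Hg] /= fg.
have E : f = g by apply: functional_extensionality_dep => p; apply: funext.
by subst g; rewrite (Prop_irrelevance Hf Hg).
Qed.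

Lemma is_chain_map_id (C : complex) : is_chain_map (fun p (x : C p) => x).
Proof. by split. Qed.

Lemma is_chain_map_comp (C D E : complex) (g : chain_map D E)
  (f : chain_map C D) : is_chain_map (fun p x => g p (f p x)).
Proof.
case: f g => [f [f1 f2]] [g [g1 g2]] /=; split=> p.
  by move=> a x y; rewrite f1 g1.
by move=> x; rewrite f2 g2.
Qed.

Definition Ch : category.
refine (@Category complex chain_map
  (fun C => ChainMap (is_chain_map_id C))
  (fun C D E g f => ChainMap (is_chain_map_comp g f)) _ _ _).
- by move=> *; apply: chain_map_inj.
- by move=> *; apply: chain_map_inj.
- by move=> *; apply: chain_map_inj.
Defined.

End ChainComplexes.

Section ExteriorPower.
Variables (A : comNzRingType) (n : nat).

(* i_0 < ... < i_(p-1): the indices of the basis e^(i_0) /\ ... /\ e^(i_(p-1))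
   of the p-th exterior power of the free module A^n. *)
Definition incr p := {t : p.-tuple 'I_n | sorted ltn (map val t)}.

(* The p-th exterior power of A^n, an element being given by its coordinates
   in that basis; see [extpow_universal].  The index set is empty for p > n,
   and the regular module A^o provides the A-module structure. *)
Definition extpow p := {ffun incr p -> A^o}.

(* v_0 /\ ... /\ v_(p-1) for v_k the rows of v; its coordinates are minors. *)
Definition wedge p (v : 'M[A]_(p, n)) : extpow p :=
  [ffun t => \det (colsub (tnth (val t)) v)].

Definition wedge_basis p (i : 'I_p -> 'I_n) : extpow p :=
  wedge (rowsub i 1%:M).

Definition multilinear p (M : lmodType A) (g : 'M[A]_(p, n) -> M) : Prop :=
  forall (k : 'I_p) (a : A) (u v w : 'M[A]_(p, n)),
    row k w = a *: row k u + row k v ->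
    row' k u = row' k w -> row' k v = row' k w ->
    g w = a *: g u + g v.

Definition alternating p (M : lmodType A) (g : 'M[A]_(p, n) -> M) : Prop :=
  forall (k l : 'I_p) (v : 'M[A]_(p, n)),
    k != l -> row k v = row l v -> g v = 0.

Lemma wedge_multilinear p : multilinear (@wedge p).
Proof.
move=> k a u v w kE uE vE; apply/ffunP => t; rewrite !ffunE.
rewrite (determinant_multilinear (A := colsub (tnth (val t)) w)
  (B := colsub (tnth (val t)) u) (C := colsub (tnth (val t)) v)
  (i0 := k) (b := a) (c := 1)) ?mul1r //.
- apply/rowP => j; have /rowP/(_ (tnth (val t) j)) := kE.
  by rewrite !mxE mul1r.
- apply/matrixP => i j; have /matrixP/(_ i (tnth (val t) j)) := uE.
  by rewrite !mxE.
- apply/matrixP => i j; have /matrixP/(_ i (tnth (val t) j)) := vE.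
  by rewrite !mxE.
Qed.

Lemma wedge_alternating p : alternating (@wedge p).
Proof.
move=> k l v kl E; apply/ffunP => t; rewrite !ffunE.
apply: (determinant_alternate kl) => j.
by have /rowP/(_ (tnth (val t) j)) := E; rewrite !mxE.
Qed.

Lemma incr_lt p (t : incr p) (k l : 'I_p) :
  (k < l)%N -> (tnth (val t) k < tnth (val t) l)%N.
Proof.
move=> kl; case: t => t /= ts.
have H := sorted_ltn_nth ltn_trans 0%N ts k l.
move: H; rewrite !inE size_map size_tuple !ltn_ord => /(_ isT isT kl).
by rewrite !(nth_map (tnth t k)) ?size_tuple // -!tnth_nth.
Qed.

Lemma incr_inj p (t : incr p) : injective (tnth (val t)).
Proof.
move=> k l E; apply/val_inj/eqP => /=; case: ltngtP => // kl.
  by have := incr_lt t kl; rewrite E ltnn.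
by have := incr_lt t kl; rewrite E ltnn.
Qed.

Lemma incr_eq p (s t : incr p) :
  {subset val t <= val s} -> s = t.
Proof.
move=> st; apply/val_inj/val_inj/(inj_map val_inj) => /=.
have ut := sorted_uniq ltn_trans ltnn (valP t).
have us := sorted_uniq ltn_trans ltnn (valP s).
apply: (irr_sorted_eq ltn_trans ltnn (valP s) (valP t)).
have st' : {subset map val (val t) <= map val (val s)}.
  by move=> _ /mapP[x xt ->]; apply/map_f/st.
have [//|_ E x] := uniq_min_size ut st'; last by rewrite E.
by rewrite !size_map !size_tuple.
Qed.

Lemma wedge_incr p (t s : incr p) :
  wedge_basis (tnth (val t)) s = (s == t)%:R.
Proof.
rewrite !ffunE; case: eqP => [->|st].
  rewrite (_ : mxsub _ _ _ = 1%:M) ?det1 //.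
  by apply/matrixP => i j; rewrite !mxE (inj_eq (@incr_inj _ _)).
have [k kP] : exists k, tnth (val t) k \notin val s.
  apply/existsP; rewrite -[X in is_true X]negbK negb_exists; apply/negP => /forallP H.
  apply: st; apply: incr_eq => x /tnthP[k ->]; have := H k.
  by rewrite negbK.
rewrite (expand_det_row _ k) big1 // => j _; rewrite !mxE.
case: eqP => [E|]; last by rewrite mul0r.
by move: kP; rewrite E mem_tnth.
Qed.

Lemma extpow_basis p (x : extpow p) :
  x = \sum_t x t *: wedge_basis (tnth (val t)).
Proof.
apply/ffunP => s; rewrite sum_ffunE (bigD1 s) //= big1 ?addr0.
  by rewrite ffunE wedge_incr eqxx [RHS]mulr1.
by move=> t /negbTE ts; rewrite ffunE wedge_incr eq_sym ts [LHS]mulr0.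
Qed.

Section Vanishing.
Variables (p : nat) (M : lmodType A) (g : 'M[A]_(p, n) -> M).
Hypotheses (gm : multilinear g) (ga : alternating g).

Definition set_row (v : 'M[A]_(p, n)) (k : 'I_p) (r : 'rV[A]_n) : 'M[A]_(p, n) :=
  \matrix_i (if i == k then r else row i v).

Lemma set_row_same v k r : row k (set_row v k r) = r.
Proof. by rewrite rowK eqxx. Qed.

Lemma set_row_other v k r l : l != k -> row l (set_row v k r) = row l v.
Proof. by move=> /negbTE lk; rewrite rowK lk. Qed.

Lemma set_row_id v k : set_row v k (row k v) = v.
Proof. by apply/row_matrixP => i; rewrite rowK; case: eqP => // ->. Qed.

Lemma set_row'K v k r r' : row' k (set_row v k r) = row' k (set_row v k r').
Proof.
by apply/matrixP => i j; rewrite !mxE eq_sym (negbTE (neq_lift _ _)).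
Qed.

Lemma set_row_linear v k : linear (fun r => g (set_row v k r)).
Proof.
move=> a r s; apply: (gm (k := k)); rewrite ?set_row_same //; exact: set_row'K.
Qed.

Lemma multilinear_sum v k : g v = \sum_j v k j *: g (set_row v k (delta_mx 0 j)).
Proof.
pose h := GRing.isLinear.Build _ _ _ _ _ (set_row_linear v k).
pose H : {linear 'rV[A]_n -> M} := HB.pack (fun r => g (set_row v k r)) h.
have -> : g v = H (row k v) by rewrite /= set_row_id.
rewrite {1}(row_sum_delta (row k v)) linear_sum; apply: eq_bigr => j _.
by rewrite linearZ /= mxE.
Qed.

Lemma multilinear_zero :
  (forall i : 'I_p -> 'I_n, g (rowsub i 1%:M) = 0) -> forall v, g v = 0.
Proof.
move=> g0.
suff H : forall s : seq 'I_p, forall v,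
    (forall k, k \notin s -> exists j, row k v = delta_mx 0 j) -> g v = 0.
  by move=> v; apply: (H (enum 'I_p)) => k; rewrite mem_enum.
elim=> [|k s IH] v vP.
  have {}vP k : {j | row k v == delta_mx 0 j}.
    by apply: sigW; have [//|j ->] := vP k; exists j.
  rewrite (_ : v = rowsub (fun k => sval (vP k)) 1%:M) //.
  apply/row_matrixP => k; rewrite (eqP (svalP (vP k))) row_rowsub row1.
  by [].
rewrite (multilinear_sum v k) big1 // => j _; rewrite IH ?scaler0 // => l ls.
have [->|lk] := eqVneq l k; first by exists j; rewrite set_row_same.
by rewrite set_row_other //; apply: vP; rewrite inE negb_or lk.
Qed.

Lemma alternating_swap v k l : k != l -> g (row_perm (tperm k l) v) = - g v.
Proof.
move=> kl; pose u r s := set_row (set_row v k r) l s.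
have uC r s : u r s = set_row (set_row v l s) k r.
  apply/row_matrixP => i; rewrite !rowK.
  case: (eqVneq i l) => [il|_]; case: (eqVneq i k) => [ik|_] //.
  by move: kl; rewrite -ik il eqxx.
have ul r s t : g (u r (s + t)) = g (u r s) + g (u r t).
  by have := set_row_linear (set_row v k r) l 1 s t; rewrite !scale1r.
have uk r s t : g (u (s + t) r) = g (u s r) + g (u t r).
  by rewrite !uC; have := set_row_linear (set_row v l r) k 1 s t; rewrite !scale1r.
have uu r : g (u r r) = 0.
  by apply: (ga kl); rewrite set_row_same set_row_other // set_row_same.
set r := row k v; set s := row l v.
have -> : v = u r s.
  by rewrite /u /r set_row_id /s set_row_id.
have -> : row_perm (tperm k l) (u r s) = u s r.
  apply/row_matrixP => i.
  have -> : row i (row_perm (tperm k l) (u r s)) = row (tperm k l i) (u r s).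
    by apply/rowP => j; rewrite !mxE.
  rewrite !rowK.
  case: tpermP => [->|->|/eqP ik /eqP il].
  - by rewrite !eqxx (negbTE kl).
  - by rewrite (negbTE kl) !eqxx.
  - by rewrite (negbTE ik) (negbTE il).
apply/eqP; rewrite -addr_eq0 addrC; apply/eqP.
by have := uu (r + s); rewrite ul !uk !uu add0r addr0 addrC.
Qed.

Lemma alternating_perm_zero (s : 'S_p) v : g (row_perm s v) = 0 -> g v = 0.
Proof.
have [ts -> dts] := prod_tpermP s.
elim: ts dts => [_|[k l] ts IH /= /andP[kl dts]]; first by rewrite big_nil row_perm1.
rewrite big_cons row_permM alternating_swap //= => /eqP.
by rewrite oppr_eq0 => /eqP; apply: IH.
Qed.

Lemma alternating_zero :
  (forall t : incr p, g (rowsub (tnth (val t)) 1%:M) = 0) -> forall v, g v = 0.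
Proof.
move=> g0; apply: multilinear_zero => i.
have [/injectiveP ii|/injectivePn[k [l kl ikl]]] := boolP (injectiveb i); last first.
  by apply: (ga kl); rewrite !row_rowsub ikl.
pose t0 := [tuple i k | k < p].
pose t := sort_tuple (fun x y : 'I_n => (x <= y)%N) t0.
have /tuple_permP[s tE] : perm_eq t t0 by rewrite /t /= perm_sort.
have ts : sorted ltn (map val t).
  rewrite ltn_sorted_uniq_leq (map_inj_uniq val_inj) sort_uniq.
  rewrite (map_inj_uniq ii) enum_uniq /= sorted_map.
  by apply: sort_sorted => x y; apply: leq_total.
apply: (@alternating_perm_zero s).
have := g0 (Sub t ts); rewrite SubK; congr (g _ = 0).
apply/matrixP => k j; rewrite !mxE; congr ((_ == _)%:R).
have {tE} -> : t = [tuple tnth t0 (s k) | k < p] by apply: val_inj; exact: tE.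
by rewrite !tnth_mktuple.
Qed.

End Vanishing.

Lemma extpow_universal p (M : lmodType A) (g : 'M[A]_(p, n) -> M) :
  multilinear g -> alternating g ->
  exists! h : extpow p -> M, linear h /\ forall v, h (wedge v) = g v.
Proof.
move=> gm ga; pose h (x : extpow p) :=
  \sum_t (x t : A) *: g (rowsub (tnth (val t)) 1%:M).
have hl : linear h.
  move=> a x y; rewrite /h scaler_sumr -big_split; apply: eq_bigr => t _ /=.
  by rewrite !ffunE scalerDl scalerA.
exists h; split; first split=> // v.
  apply/eqP; rewrite -subr_eq0; apply/eqP; move: v.
  apply: (alternating_zero (g := fun v => h (wedge v) - g v)).
  - move=> k a u v w kE uE vE.
    rewrite (wedge_multilinear kE uE vE) (gm _ _ _ _ _ kE uE vE) hl.
    by rewrite scalerBr opprD addrACA.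
  - move=> k l v kl E; rewrite (wedge_alternating kl E) (ga _ _ _ kl E) subr0.
    by rewrite /h big1 // => t _; rewrite ffunE scale0r.
  - move=> t; apply/eqP; rewrite subr_eq0; apply/eqP.
    rewrite /h (bigD1 t) //= big1 => [|s /negbTE st].
      by rewrite [wedge _ _]wedge_incr eqxx scale1r addr0.
    by rewrite [wedge _ _]wedge_incr st scale0r.
move=> h' [h'l h'w]; apply: funext => x.
pose H : {linear extpow p -> M} :=
  HB.pack h' (GRing.isLinear.Build _ _ _ _ _ h'l).
rewrite (extpow_basis x) -[h']/(H : _ -> _) linear_sum /h; apply: eq_bigr => t _.
by rewrite linearZ /= -[h' _]/(h' (wedge _)) h'w -extpow_basis.
Qed.

Definition koszul_diff (eta : 'I_n -> A) p (x : extpow p.+1) : extpow p :=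
  \sum_(t : incr p.+1) x t *:
    \sum_(j < p.+1) ((-1) ^+ j * eta (tnth (val t) j)) *:
      wedge_basis (fun k => tnth (val t) (lift j k)).

Lemma koszul_diff_basis (eta : 'I_n -> A) p (t : incr p.+1) :
  koszul_diff eta (wedge_basis (tnth (val t))) =
  \sum_(j < p.+1) ((-1) ^+ j * eta (tnth (val t) j)) *:
    wedge_basis (fun k => tnth (val t) (lift j k)).
Proof.
rewrite /koszul_diff (bigD1 t) //= wedge_incr eqxx scale1r addrC big1 ?add0r //.
by move=> s /negbTE st; rewrite wedge_incr st scale0r.
Qed.

End ExteriorPower.

Definition extpow_map (A B : comNzRingType) (f : {rmorphism A -> B}) n p
    (x : extpow A n p) : extpow B n p := [ffun t => f (x t)].

Section LeastSquares.
Variables (R : realType) (N n : nat).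

(* The carrier [m] is 'I_wsize, so a data set may be empty. *)
Record wdata := WData {
  wsize : nat;
  wpoint :> 'I_wsize -> 'rV[R]_N * R * R }.

Definition wx (D : wdata) (j : 'I_(wsize D)) : 'rV[R]_N := (D j).1.1.
Definition wy (D : wdata) (j : 'I_(wsize D)) : R := (D j).1.2.

Record wmor (D D' : wdata) := WMor {
  wfun :> 'I_(wsize D) -> 'I_(wsize D');
  wfun_inj : injective wfun;
  wfun_data : forall j, D' (wfun j) = D j }.

Lemma wmor_ext (D D' : wdata) (r s : wmor D D') : r =1 s -> r = s.
Proof.
case: r s => [r ri rd] [s si sd] /= rs.
have E : r = s by apply: funext.
by subst s; rewrite (Prop_irrelevance ri si) (Prop_irrelevance rd sd).
Qed.

Definition wmor_id (D : wdata) : wmor D D :=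
  @WMor D D id (fun _ _ => id) (fun _ => erefl).

Definition wmor_comp (D D' D'' : wdata) (s : wmor D' D'') (r : wmor D D') :
  wmor D D'' :=
  @WMor D D'' (s \o r) (inj_comp (@wfun_inj _ _ s) (@wfun_inj _ _ r))
    (fun j => etrans (wfun_data s (r j)) (wfun_data r j)).

Definition OmegaFin : category.
refine (@Category wdata wmor wmor_id wmor_comp _ _ _).
- by move=> *; apply: wmor_ext.
- by move=> *; apply: wmor_ext.
- by move=> *; apply: wmor_ext.
Defined.

(* R[a^1, ..., a^n, w^1, ..., w^m]: the first n variables are the parameters. *)
Local Notation lsring D := {mpoly R[n + wsize D]}.

Definition avar (D : wdata) (l : 'I_n) : lsring D := 'X_(lshift (wsize D) l).
Definition wvar (D : wdata) (j : 'I_(wsize D)) : lsring D := 'X_(rshift n j).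

Definition pullback_var (D D' : wdata) (r : wmor D D') (i : 'I_(n + wsize D')) :
  lsring D :=
  match split i with
  | inl l => avar D l
  | inr j' => if [pick j | r j == j'] is Some j then wvar j else 0
  end.

Definition pullback (D D' : wdata) (r : wmor D D') :
  {lrmorphism lsring D' -> lsring D} :=
  comp_mpoly [tuple pullback_var r i | i < n + wsize D'].

Definition ls_koszul_map (D D' : wdata) (r : wmor D D') p
    (x : extpow (lsring D') n p) : extpow (lsring D) n p :=
  extpow_map (pullback r) x.

Variable phi : 'rV[R]_N -> 'rV[R]_n.

Definition sqloss (D : wdata) : lsring D :=
  \sum_(j < wsize D)
    ((wy j)%:MP - \sum_(l < n) phi (wx j) 0 l *: avar D l) ^+ 2 * wvar j.

Definition lseta (D : wdata) (i : 'I_n) : lsring D :=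
  (sqloss D)^`M(lshift (wsize D) i).

(* Over R the scalars act on coefficients, i.e. by restriction of scalars. *)
Definition ls_koszul (D : wdata) : graded R :=
  @Graded R (fun p => {ffun incr n p -> lsring D})
    (fun p => koszul_diff (lseta D) (p := p)).

End LeastSquares.

Arguments pullback {R N} n {D D'} r.
Arguments ls_koszul_map {R N} n {D D'} r p x.

(* Main.v *)
(* The map induced by a ring morphism f is a chain map from the Koszul complex
   of eta to that of f o eta, so everything reduces to rho^*(eta'^i) = eta^i.
   Each eta^i is a sum over the data points of a multiple of the weight
   variable, and rho^* sends w^j' to the sum of the w^j with rho(j) = j', which
   is zero or a single variable.  In that form rho^* re-indexes the sum over D'
   as a sum over D, kills the points outside the image of rho, and is
   functorial in rho. *)

Require Import Defs.
From HB Require Import structures.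
From mathcomp Require Import all_boot all_order all_algebra.
From mathcomp Require Import boolp reals.
From mathcomp Require Import mpoly.
From mathcomp Require Import zify.

Set Implicit Arguments.
Unset Strict Implicit.
Unset Printing Implicit Defensive.

Import GRing.Theory.
Local Open Scope ring_scope.

(** * Koszul complexes: the differential squares to zero *)

(** The pairs [(j, k)] with [j <= k] are matched with the pairs [(k + 1, j)], which are exactly
    those whose first index exceeds the second, and matched terms cancel. *)
Lemma face_sum_eq0 (V : zmodType) p (F : 'I_p.+2 -> 'I_p.+1 -> V) :
  (forall j k : 'I_p.+1, (j <= k)%N ->
     F (widen_ord (leqnSn _) j) k = - F (lift ord0 k) j) ->
  \sum_j \sum_k F j k = 0.
Proof.
move=> FN; rewrite exchange_big /=.
have split_sum (k : 'I_p.+1) : \sum_j F j k =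
    \sum_(j < p.+1 | (j <= k)%N) F (widen_ord (leqnSn _) j) k +
    \sum_(j < p.+1 | (k <= j)%N) F (lift ord0 j) k.
  rewrite (bigID (fun j : 'I_p.+2 => (j <= k)%N)) /=; congr (_ + _).
    by rewrite big_mkcond big_ord_recr /= leqNgt ltn_ord addr0 -big_mkcond.
  rewrite big_mkcond big_ord_recl /= add0r -big_mkcond.
  by apply: eq_bigl => j; rewrite -ltnNge.
rewrite (eq_bigr _ (fun k _ => split_sum k)) big_split /=.
(* Swapping the two indices in the second half makes both halves run over [j <= k]. *)
rewrite [X in _ + X](exchange_big_dep xpredT) //= -big_split big1 // => k _.
by rewrite -big_split big1 // => j jk; rewrite /= FN // addNr.
Qed.

Section Koszul.
Variables (A : comNzRingType) (n : nat).

Lemma face_subproof p (t : incr n p.+1) (j : 'I_p.+1) :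
  sorted ltn (map val [tuple tnth (val t) (lift j k) | k < p]).
Proof.
rewrite sorted_map sorted_pairwise => [|x y z]; last exact: ltn_trans.
apply/(pairwiseP (tnth (val t) ord0)) => k l; rewrite !inE size_tuple => kp lp kl.
have E i (ip : (i < p)%N) : nth (tnth (val t) ord0)
    [tuple tnth (val t) (lift j k) | k < p] i = tnth (val t) (lift j (Ordinal ip)).
  by rewrite -(tnth_nth _ _ (Ordinal ip)) tnth_mktuple.
rewrite /= (E _ kp) (E _ lp); apply: incr_lt => /=.
by rewrite /bump; lia.
Qed.

(** Keeping the faces inside [incr] lets the basis formula for the differential be applied a second
    time. *)
Definition face p (t : incr n p.+1) (j : 'I_p.+1) : incr n p :=
  Sub [tuple tnth (val t) (lift j k) | k < p] (face_subproof t j).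

Lemma tnth_face p (t : incr n p.+1) j k :
  tnth (val (face t j)) k = tnth (val t) (lift j k).
Proof. by rewrite tnth_mktuple. Qed.

(** The simplicial identity: both sides delete positions [j] and [k + 1] of [t], in opposite
    orders. *)
Lemma face_face p (t : incr n p.+2) (j k : 'I_p.+1) : (j <= k)%N ->
  face (face t (widen_ord (leqnSn _) j)) k = face (face t (lift ord0 k)) j.
Proof.
move=> jk; apply/val_inj/eq_from_tnth => i; rewrite !tnth_face.
by congr tnth; apply/val_inj; rewrite /= /bump; lia.
Qed.

Variable eta : 'I_n -> A.

Lemma koszul_diff_sum (I : finType) p (F : I -> extpow A n p.+1) :
  koszul_diff eta (\sum_i F i) = \sum_i koszul_diff eta (F i).
Proof.
rewrite /koszul_diff exchange_big; apply: eq_bigr => t _ /=.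
by rewrite sum_ffunE scaler_suml.
Qed.

Lemma koszul_diffD p : {morph @koszul_diff A n eta p : x y / x + y}.
Proof.
move=> x y; rewrite /koszul_diff -big_split; apply: eq_bigr => t _ /=.
by rewrite ffunE scalerDl.
Qed.

Lemma koszul_diffZ p (c : A) (x : extpow A n p.+1) :
  koszul_diff eta (c *: x) = c *: koszul_diff eta x.
Proof.
by rewrite /koszul_diff scaler_sumr; apply: eq_bigr => t _; rewrite ffunE scalerA.
Qed.

Lemma koszul_diff_face p (t : incr n p.+1) :
  koszul_diff eta (wedge_basis A (tnth (val t))) =
  \sum_(j < p.+1) ((-1) ^+ j * eta (tnth (val t) j)) *:
    wedge_basis A (tnth (val (face t j))).
Proof.
rewrite koszul_diff_basis; apply: eq_bigr => j _; congr (_ *: wedge_basis _ _).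
by apply: funext => k; rewrite tnth_face.
Qed.

Lemma koszul_diff_sq0 p (x : extpow A n p.+2) :
  koszul_diff eta (koszul_diff eta x) = 0.
Proof.
rewrite [in X in koszul_diff _ X]/koszul_diff koszul_diff_sum big1 // => t _.
rewrite koszul_diffZ -koszul_diff_basis koszul_diff_face koszul_diff_sum.
under eq_bigr => j _ do rewrite koszul_diffZ koszul_diff_face scaler_sumr.
rewrite face_sum_eq0 ?scaler0 // => j k jk.
rewrite !scalerA face_face // -scaleNr !tnth_face; congr (_ *: _).
(* As [j <= k], position [k] after deleting [j] is position [k + 1] of [t], while deleting [k + 1]
   leaves position [j] in place. *)
have -> : lift (widen_ord (leqnSn p.+1) j) k = lift ord0 k.
  by apply: val_inj; rewrite /= /bump; lia.
have -> : lift (lift ord0 k) j = widen_ord (leqnSn p.+1) j.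
  by apply: val_inj; rewrite /= /bump; lia.
(* The exponents [j + k] and [(k + 1) + j] differ by one, whence the sign. *)
rewrite /= /bump leq0n exprS !mulN1r !mulNr opprK mulrACA [RHS]mulrACA.
by congr (_ * _); apply: mulrC.
Qed.

End Koszul.

(** * Change of coefficients along a ring morphism *)

Section KoszulMap.
Variables (A B : comNzRingType) (f : {rmorphism A -> B}) (n : nat).

Lemma extpow_map_semilinear p (c : A) (x y : extpow A n p) :
  extpow_map f (c *: x + y) = f c *: extpow_map f x + extpow_map f y.
Proof. by apply/ffunP => t; rewrite !ffunE rmorphD rmorphM. Qed.

Lemma extpow_map_sum (I : finType) p (F : I -> extpow A n p) :
  extpow_map f (\sum_i F i) = \sum_i extpow_map f (F i).
Proof.
apply/ffunP => t; rewrite ffunE !sum_ffunE rmorph_sum.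
by apply: eq_bigr => i _; rewrite ffunE.
Qed.

Lemma extpow_mapZ p (c : A) (x : extpow A n p) :
  extpow_map f (c *: x) = f c *: extpow_map f x.
Proof. by apply/ffunP => t; rewrite !ffunE rmorphM. Qed.

(** The coordinates are minors of a matrix with entries 0 and 1, which [f] preserves. *)
Lemma extpow_map_basis p (i : 'I_p -> 'I_n) :
  extpow_map f (wedge_basis A i) = wedge_basis B i.
Proof.
apply/ffunP => t; rewrite !ffunE -det_map_mx; congr (\det _).
by apply/matrixP => k l; rewrite !mxE rmorph_nat.
Qed.

Lemma extpow_map_koszul_diff (eta : 'I_n -> A) p (x : extpow A n p.+1) :
  extpow_map f (koszul_diff eta x) = koszul_diff (f \o eta) (extpow_map f x).
Proof.
rewrite /koszul_diff extpow_map_sum; apply: eq_bigr => t _.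
rewrite extpow_mapZ extpow_map_sum ffunE; congr (_ *: _); apply: eq_bigr => j _.
by rewrite extpow_mapZ extpow_map_basis rmorphM rmorphXn rmorphN1.
Qed.

End KoszulMap.

(** * Polynomial rings and the pullback of variables *)

Lemma mpoly_lrmorph_ext (R : comNzRingType) k (S : comAlgType R)
    (f g : {lrmorphism {mpoly R[k]} -> S}) :
  (forall i, f 'X_i = g 'X_i) -> f =1 g.
Proof.
move=> fg; elim/mpolyind => [|c m p _ _ IH]; first by rewrite !rmorph0.
rewrite !linearD !linearZ /= IH; congr (_ *: _ + _).
by rewrite mpolyXE_id !rmorph_prod; apply: eq_bigr => i _; rewrite !rmorphXn /= fg.
Qed.

Lemma mderivXU (R : nzRingType) k (i j : 'I_k) : ('X_j)^`M(i) = (j == i)%:R :> {mpoly R[k]}.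
Proof.
rewrite mderivX mnm1E; case: eqP => [->|_]; last by rewrite scale0r.
by rewrite scale1r -[X in (X - _)%MM]add0m addmK mpolyX0.
Qed.

Section LeastSquaresKoszul.
Variables (R : realType) (N n : nat).

Section Pullback.
Variables (D D' : wdata R N) (r : wmor D D').

Lemma pullbackX i : pullback n r 'X_i = pullback_var r i.
Proof. by rewrite /= comp_mpolyXU -tnth_nth tnth_mktuple. Qed.

Lemma pullback_avar l : pullback n r (avar D' l) = avar D l.
Proof. by rewrite pullbackX /pullback_var -[lshift _ l]/(unsplit (inl l)) unsplitK. Qed.

(** Injectivity of [r] leaves at most one point in each fibre. The sum form replaces later case
    distinctions on the image by exchanges of sums. *)
Lemma pullback_wvar j' :
  pullback n r (wvar n j') = \sum_(j | r j == j') wvar n j.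
Proof.
rewrite pullbackX /pullback_var -[rshift _ _]/(unsplit (inr j')) unsplitK.
case: pickP => [j /eqP rj|rj].
  by rewrite (big_pred1 j) // => i; rewrite -rj (inj_eq (@wfun_inj _ _ _ _ r)).
by rewrite big_pred0.
Qed.

End Pullback.

Lemma lsring_lrmorph_ext (D : wdata R N) (S : comAlgType R)
    (f g : {lrmorphism {mpoly R[n + wsize D]} -> S}) :
  (forall l, f (avar D l) = g (avar D l)) ->
  (forall j, f (wvar n j) = g (wvar n j)) -> f =1 g.
Proof.
move=> fga fgw; apply: mpoly_lrmorph_ext => i.
by rewrite -(splitK i); case: (split i) => [l|j]; [apply: fga | apply: fgw].
Qed.

Lemma pullback_id (D : wdata R N) : pullback n (wmor_id D) =1 idfun.
Proof.
apply: lsring_lrmorph_ext => [l|j]; first exact: pullback_avar.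
by rewrite pullback_wvar (big_pred1_eq _ j).
Qed.

Lemma pullback_comp (D D' D'' : wdata R N) (s : wmor D' D'') (r : wmor D D') :
  pullback n (wmor_comp s r) =1 pullback n r \o pullback n s.
Proof.
apply: lsring_lrmorph_ext => [l|j].
  by rewrite /= [in RHS]pullback_avar !pullback_avar.
transitivity (pullback n r (pullback n s (wvar n j))) => //.
rewrite !pullback_wvar rmorph_sum.
rewrite [RHS](eq_bigr _ (fun j' _ => pullback_wvar r j')).
(* The fibre of [s \o r] over [j] is the disjoint union of the fibres of [r] over the points [j']
   with [s j' = j]; each [i] in it occurs only for [j' = r i]. *)
rewrite (exchange_big_dep (fun i => s (r i) == j)) => [|j' i /eqP <- /eqP <- //] /=.
apply: eq_bigr => i rij; rewrite (big_pred1 (r i)) // => j'.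
rewrite /= [RHS]eq_sym; case: (r i =P j') => [<-|_]; last by rewrite andbF.
by rewrite rij.
Qed.

(** * The least squares coefficients and their complexes *)

Section LS.
Variable phi : 'rV[R]_N -> 'rV[R]_n.

Definition residual (D : wdata R N) (j : 'I_(wsize D)) : {mpoly R[n + wsize D]} :=
  (wy j)%:MP - \sum_(l < n) phi (wx j) 0 l *: avar D l.

Lemma pullback_residual (D D' : wdata R N) (r : wmor D D') j :
  pullback n r (residual (r j)) = residual j.
Proof.
rewrite /residual /wx /wy (wfun_data r) rmorphB rmorph_sum.
congr (_ - _); first exact: comp_mpolyC.
by apply: eq_bigr => l _; rewrite -[RHS](congr1 _ (pullback_avar r l)); exact: linearZ.
Qed.

Lemma lsetaE (D : wdata R N) i :
  lseta phi D i = \sum_(j < wsize D)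
    (- 2 * phi (wx j) 0 i) *: (residual j * wvar n j).
Proof.
rewrite /lseta /sqloss raddf_sum; apply: eq_bigr => j _ /=.
rewrite -/(residual j) mderivM.
(* Weight variables are constant for the parameter derivatives. *)
have -> : (wvar n j)^`M(lshift (wsize D) i) = 0.
  by rewrite mderivXU eq_rlshift.
have -> : (residual j ^+ 2)^`M(lshift (wsize D) i) =
    (- 2 * phi (wx j) 0 i) *: residual j.
  rewrite expr2 mderivM.
  have -> : (residual j)^`M(lshift (wsize D) i) = - (phi (wx j) 0 i)%:MP.
    rewrite mderivB mderivC sub0r; congr (- _).
    rewrite raddf_sum (bigD1 i) //= big1 => [|l li].
      by rewrite addr0 mderivZ mderivXU eqxx alg_mpolyC.
    by rewrite mderivZ mderivXU eq_lshift (negbTE li) scaler0.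
  (* The two terms of the product rule coincide, which gives the factor 2. *)
  rewrite !mulNr mulrN [residual j * _]mulrC mul_mpolyC -mulr2n -scaler_nat.
  by rewrite scalerN scalerA scaleNr.
by rewrite mulr0 addr0 scalerAl.
Qed.

Lemma pullback_lseta (D D' : wdata R N) (r : wmor D D') (i : 'I_n) :
  pullback n r (lseta phi D' i) = lseta phi D i.
Proof.
have pullback_term j' (c : R) :
    pullback n r (c *: (residual j' * wvar n j')) =
    \sum_(j | r j == j') c *: (pullback n r (residual j') * wvar n j).
  rewrite -scaler_sumr -mulr_sumr -pullback_wvar -rmorphM; exact: linearZ.
rewrite !lsetaE linear_sum (eq_bigr _ (fun j' _ => pullback_term j' _)).
(* The fibres of [r] partition the points of [D], so each [j] keeps the single term [j' = r j],
   where the data agree. *)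
rewrite (exchange_big_dep xpredT) //=; apply: eq_bigr => j _.
rewrite (big_pred1 (r j)) => [|k]; last by rewrite eq_sym.
by rewrite pullback_residual /wx (wfun_data r).
Qed.

(* The left-hand side is the real scaling of the chain complex, the right-hand
   side the scaling by the polynomial ring. *)
Lemma ls_koszul_scaleE (D : wdata R N) p (c : R) (x : ls_koszul phi D p) :
  c *: x = (c%:MP *: (x : extpow {mpoly R[n + wsize D]} n p)).
Proof. by apply/ffunP => t; rewrite !ffunE; apply/esym/mul_mpolyC. Qed.

Lemma ls_koszul_is_complex (D : wdata R N) : is_complex (ls_koszul phi D).
Proof.
split=> [p c x y|p x]; last exact: koszul_diff_sq0.
rewrite !ls_koszul_scaleE -koszul_diffZ; exact: koszul_diffD.
Qed.

Lemma ls_koszul_map_is_chain_map (D D' : wdata R N) (r : wmor D D') :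
  @is_chain_map R (ls_koszul phi D') (ls_koszul phi D) (ls_koszul_map n r).
Proof.
split=> [p c x y|p x].
  (* The pullback fixes real constants, so semilinearity gives linearity over [R]. *)
  rewrite !ls_koszul_scaleE -(comp_mpolyC c [tuple pullback_var r i | i < n + wsize D']).
  exact: extpow_map_semilinear.
have lsetaP : pullback n r \o lseta phi D' = lseta phi D.
  by apply: funext => i; apply: pullback_lseta.
by apply: etrans (extpow_map_koszul_diff (pullback n r) (lseta phi D') x) _; rewrite lsetaP.
Qed.

End LS.
End LeastSquaresKoszul.

Theorem theorem1p3 (R : realType) (N n : nat) (hN : (1 <= N)%N) (hn : (1 <= n)%N)
    (phi : 'rV[R]_N -> 'rV[R]_n) :
  exists (cplx : forall D : wdata R N, is_complex (ls_koszul phi D))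
         (chm : forall (D' D : wdata R N) (rho : wmor D D'),
            @is_chain_map R (ls_koszul phi D') (ls_koszul phi D)
              (ls_koszul_map n rho)),
    @is_functor (opposite (OmegaFin R N)) (Ch R)
      (fun D => Complex (cplx D))
      (fun D' D rho =>
         @ChainMap R (Complex (cplx D')) (Complex (cplx D))
           (ls_koszul_map n rho) (chm D' D rho)) /\
    (forall (D D' : wdata R N) (rho : wmor D D') (p : nat)
            (c : {mpoly R[n + wsize D']})
            (x y : extpow {mpoly R[n + wsize D']} n p),
       ls_koszul_map n rho p (c *: x + y) =
       pullback n rho c *: ls_koszul_map n rho p x + ls_koszul_map n rho p y).
Proof.
exists (ls_koszul_is_complex phi), (fun D' D r => ls_koszul_map_is_chain_map phi r).
split; last by move=> D D' r p c x y; apply: extpow_map_semilinear.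
(* Compared coordinate by coordinate, both functor laws become those of [pullback]. *)
split=> [D|D D' D'' s r]; apply: chain_map_inj => p x; apply/ffunP => t; rewrite !ffunE.
  exact: pullback_id.
exact: pullback_comp.
Qed.
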